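(* Let $\Gamma$ be any context of $\lambda\mathsf{HOL}$ (possibly extended by constants and additional conversion rules) in which there are a type $A:\square$ and terms $\mathsf{intro}:T\,A\to A$ and $\mathsf{match}:A\to T\,A$ such that, for every $u:T\,A$, the term $\mathsf{match}\,(\mathsf{intro}\,u)$ is judgementally equal to $u$ (i.e. $T\,A$ is a judgemental retract of $A$). Then there is a term of type $\perp$ in $\Gamma$. In other words, in $\lambda\mathsf{HOL}$ one cannot have a type $A$ such that $\mathsf{Pow}\,(\mathsf{Pow}\,A)$ is a judgemental retract of $A$ without the system becoming inconsistent.
   Context: $\lambda\mathsf{HOL}$ (minimal higher-order logic) is the pure type system with sorts $*,\square,\Delta$, axioms $*:\square$ and $\square:\Delta$, and rules $( *,* )$, $(\square,\square)$, $(\square,* )$; judgemental equality is $\beta$-conversion. Define $\mathsf{Pow}:\square\to\square$ by $\mathsf{Pow}\,X = X\to *$ and $T:\square\to\square$ by $T\,X=\mathsf{Pow}(\mathsf{Pow}\,X)$. Define $\perp:*$ by $\perp=\forall_{p:*}\,p$ and $\neg p = p\to\perp$. *)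

(* Defs.v *)
From Stdlib Require Import List Arith Relations.
Import ListNotations.

Inductive sort : Type := Star | Box | Delta.

Inductive term : Type :=
| tSort  : sort -> term
| tVar   : nat -> term
| tConst : nat -> term
| tApp   : term -> term -> term
| tLam   : term -> term -> term
| tPi    : term -> term -> term.

Fixpoint lift (k n : nat) (t : term) : term :=
  match t with
  | tSort s => tSort s
  | tVar i => if k <=? i then tVar (i + n) else tVar i
  | tConst c => tConst c
  | tApp f a => tApp (lift k n f) (lift k n a)
  | tLam A b => tLam (lift k n A) (lift (S k) n b)
  | tPi A B => tPi (lift k n A) (lift (S k) n B)
  end.

Fixpoint subst (k : nat) (u : term) (t : term) : term :=
  match t with
  | tSort s => tSort s
  | tVar i => if i <? k then tVar i
              else if i =? k then lift 0 k u
              else tVar (pred i)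
  | tConst c => tConst c
  | tApp f a => tApp (subst k u f) (subst k u a)
  | tLam A b => tLam (subst k u A) (subst (S k) u b)
  | tPi A B => tPi (subst k u A) (subst (S k) u B)
  end.

Definition rules := term -> term -> Prop.

Inductive red1 (R : rules) : term -> term -> Prop :=
| red1_beta : forall A b u, red1 R (tApp (tLam A b) u) (subst 0 u b)
| red1_rule : forall t t', R t t' -> red1 R t t'
| red1_appl : forall f f' a, red1 R f f' -> red1 R (tApp f a) (tApp f' a)
| red1_appr : forall f a a', red1 R a a' -> red1 R (tApp f a) (tApp f a')
| red1_laml : forall A A' b, red1 R A A' -> red1 R (tLam A b) (tLam A' b)
| red1_lamr : forall A b b', red1 R b b' -> red1 R (tLam A b) (tLam A b')
| red1_pil  : forall A A' B, red1 R A A' -> red1 R (tPi A B) (tPi A' B)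
| red1_pir  : forall A B B', red1 R B B' -> red1 R (tPi A B) (tPi A B').

Definition conv (R : rules) : term -> term -> Prop :=
  clos_refl_sym_trans term (red1 R).

Inductive axiom : sort -> sort -> Prop :=
| ax_star : axiom Star Box
| ax_box  : axiom Box Delta.

Inductive rule : sort -> sort -> Prop :=
| rl_ss : rule Star Star
| rl_bb : rule Box Box
| rl_bs : rule Box Star.

(* Signature: types of constants (closed terms). *)
Definition signature := nat -> option term.

(* Contexts: head of the list is the type of variable 0. *)
Definition context := list term.

Inductive wf (Sg : signature) (R : rules) : context -> Prop :=
| wf_nil : wf Sg R []
| wf_cons : forall G A s, typ Sg R G A (tSort s) -> wf Sg R (A :: G)
with typ (Sg : signature) (R : rules) : context -> term -> term -> Prop :=
| t_sort : forall G s1 s2, wf Sg R G -> axiom s1 s2 ->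
    typ Sg R G (tSort s1) (tSort s2)
| t_var : forall G n A, wf Sg R G -> nth_error G n = Some A ->
    typ Sg R G (tVar n) (lift 0 (S n) A)
| t_const : forall G c T s, wf Sg R G -> Sg c = Some T ->
    typ Sg R [] T (tSort s) -> typ Sg R G (tConst c) T
| t_pi : forall G A B s1 s2, rule s1 s2 ->
    typ Sg R G A (tSort s1) -> typ Sg R (A :: G) B (tSort s2) ->
    typ Sg R G (tPi A B) (tSort s2)
| t_lam : forall G A b B s,
    typ Sg R (A :: G) b B -> typ Sg R G (tPi A B) (tSort s) ->
    typ Sg R G (tLam A b) (tPi A B)
| t_app : forall G f a A B,
    typ Sg R G f (tPi A B) -> typ Sg R G a A ->
    typ Sg R G (tApp f a) (subst 0 a B)
| t_conv : forall G a A B s,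
    typ Sg R G a A -> typ Sg R G B (tSort s) -> conv R A B ->
    typ Sg R G a B.

Definition arr (A B : term) : term := tPi A (lift 0 1 B).

(* Pow X = X -> *,  T X = Pow (Pow X) (meta-level abbreviations;
   beta-equal to the lambda-HOL functions Pow, T : box -> box applied to X) *)
Definition Pow (X : term) : term := arr X (tSort Star).
Definition TT (X : term) : term := Pow (Pow X).

Definition bot : term := tPi (tSort Star) (tVar 0).

(* Main.v *)
(** Write [match] for the retraction.  The predicate
    [russell x := forall p : Pow A, match x p -> ~ p x] is applied to
    [point := intro (fun q => russell = q)], with Leibniz equality on [Pow A].
    Since [match point q] is judgementally [russell = q], we get
    [~ russell point] by taking [p := russell], and then [russell point] by
    rewriting along [russell = p].

    The relation [R] is not assumed to be stable under renaming, but conversion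
    is: a conversion goes under abstractions, and beta-reducing these
    abstractions applied to variables performs any renaming.  Hence weakening
    holds. *)

From Stdlib Require Import Arith Lia Relations.
Require Import Defs.
From Stdlib Require Import List.
Import ListNotations.

Ltac nat_cases :=
  repeat match goal with
  | |- context [?a <=? ?b] => destruct (Nat.leb_spec a b)
  | |- context [?a <? ?b] => destruct (Nat.ltb_spec a b)
  | |- context [?a =? ?b] => destruct (Nat.eqb_spec a b)
  end.

(** * Lifting and substitution *)

Lemma lift_0 (t : term) : forall k, lift k 0 t = t.
Proof.
  induction t; intro k; simpl; try (f_equal; auto; fail).
  destruct (k <=? n); f_equal; lia.
Qed.

Lemma lift_lift_comm (t : term) : forall j k m n, j <= k ->
  lift (m + k) n (lift j m t) = lift j m (lift k n t).
Proof.
  induction t; intros j k m p Hjk; simpl; try (f_equal; auto; fail).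
  - nat_cases; simpl; nat_cases; f_equal; lia.
  - f_equal; auto. rewrite plus_n_Sm. apply IHt2. lia.
  - f_equal; auto. rewrite plus_n_Sm. apply IHt2. lia.
Qed.

Lemma lift_lift_merge (t : term) : forall j k m n, j <= k <= j + m ->
  lift k n (lift j m t) = lift j (m + n) t.
Proof.
  induction t; intros j k m p Hjk; simpl; try (f_equal; auto; fail).
  - nat_cases; simpl; nat_cases; f_equal; lia.
  - f_equal; auto. apply IHt2. lia.
  - f_equal; auto. apply IHt2. lia.
Qed.

Lemma subst_lift_cancel (t : term) : forall k u, subst k u (lift k 1 t) = t.
Proof.
  induction t; intros k u; simpl; try (f_equal; auto; fail).
  nat_cases; simpl; nat_cases; try lia; f_equal; lia.
Qed.

Lemma subst_lift_comm (t : term) : forall j k u, j <= k ->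
  subst (S k) u (lift j 1 t) = lift j 1 (subst k u t).
Proof.
  induction t; intros j k u Hjk; simpl; try (f_equal; auto; fail).
  - nat_cases; simpl; nat_cases; try lia; try (f_equal; lia).
    rewrite lift_lift_merge by lia. f_equal; lia.
  - f_equal; auto. apply IHt2. lia.
  - f_equal; auto. apply IHt2. lia.
Qed.

(** Writing the cutoff as [j + k] makes the induction under a binder raise [j] alone. The instance
    [j = 0] is the one that matches the type in the application rule. *)
Lemma lift_subst (t : term) : forall j k n u,
  lift (j + k) n (subst j u t) = subst j (lift k n u) (lift (S (j + k)) n t).
Proof.
  induction t; intros j k p u; cbn [lift subst]; try (f_equal; auto; fail).
  - nat_cases; cbn [lift subst]; nat_cases; try lia; try (f_equal; lia).
    apply lift_lift_comm. lia.
  - f_equal; auto. apply (IHt2 (S j)).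
  - f_equal; auto. apply (IHt2 (S j)).
Qed.

Lemma lift_arr (k n : nat) (A B : term) :
  lift k n (arr A B) = arr (lift k n A) (lift k n B).
Proof.
  unfold arr; simpl. f_equal. apply (lift_lift_comm B 0 k 1 n). lia.
Qed.

Lemma subst_arr (k : nat) (u A B : term) :
  subst k u (arr A B) = arr (subst k u A) (subst k u B).
Proof.
  unfold arr; simpl. f_equal. apply subst_lift_comm. lia.
Qed.

(** This bound serves two purposes: types of constants turn out to be invariant under lifting, and
    two convertible terms have a common bound beyond which a renaming may be altered freely. *)
Fixpoint closed (n : nat) (t : term) : Prop :=
  match t with
  | tSort _ | tConst _ => True
  | tVar i => i < n
  | tApp f a => closed n f /\ closed n a
  | tLam A b => closed n A /\ closed (S n) b
  | tPi A B => closed n A /\ closed (S n) B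
  end.

Lemma closed_weaken (t : term) : forall m n, m <= n -> closed m t -> closed n t.
Proof.
  induction t; simpl; intros m p Hmp Ht; auto; try lia.
  - destruct Ht; split; eauto.
  - destruct Ht; split; eauto. apply (IHt2 (S m)); auto; lia.
  - destruct Ht; split; eauto. apply (IHt2 (S m)); auto; lia.
Qed.

Lemma closed_exists (t : term) : exists n, closed n t.
Proof.
  induction t as [s|i|c|f [n Hf] a [m Ha]|A [n HA] b [m Hb]|A [n HA] b [m Hb]];
    simpl; try (exists 0; exact I).
  - exists (S i); lia.
  - exists (n + m); split; (eapply closed_weaken; [|eassumption]; lia).
  - exists (n + m); split; (eapply closed_weaken; [|eassumption]; lia).
  - exists (n + m); split; (eapply closed_weaken; [|eassumption]; lia).
Qed.

Lemma lift_closed (t : term) : forall k n, closed k t -> lift k n t = t.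
Proof.
  induction t; simpl; intros k p Ht; auto; try (destruct Ht; f_equal; auto; fail).
  nat_cases; auto; lia.
Qed.

(** * Renaming and conversion *)

Definition up (f : nat -> nat) (i : nat) : nat :=
  match i with 0 => 0 | S j => S (f j) end.

(** Arbitrary functions on indices are allowed because the renamings met in the induction of
    [conv_rename_prefix] are not all of the form [lift k n]. *)
Fixpoint rename (f : nat -> nat) (t : term) : term :=
  match t with
  | tSort s => tSort s
  | tVar i => tVar (f i)
  | tConst c => tConst c
  | tApp g a => tApp (rename f g) (rename f a)
  | tLam A b => tLam (rename f A) (rename (up f) b)
  | tPi A B => tPi (rename f A) (rename (up f) B)
  end.

Lemma rename_ext (t : term) : forall n f g, closed n t ->
  (forall i, i < n -> f i = g i) -> rename f t = rename g t.
Proof.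
  induction t; simpl; intros p f g Ht Hfg; auto.
  - destruct Ht; f_equal; eauto.
  - destruct Ht; f_equal; eauto. apply (IHt2 (S p)); auto.
    intros [|i] Hi; simpl; auto. f_equal; apply Hfg; lia.
  - destruct Ht; f_equal; eauto. apply (IHt2 (S p)); auto.
    intros [|i] Hi; simpl; auto. f_equal; apply Hfg; lia.
Qed.

Lemma rename_id (t : term) : forall f, (forall i, f i = i) -> rename f t = t.
Proof.
  induction t; simpl; intros f Hf; auto; f_equal; auto.
  - apply IHt2. intros [|i]; simpl; auto.
  - apply IHt2. intros [|i]; simpl; auto.
Qed.

Lemma rename_lift (t : term) : forall k n f,
  (forall i, f i = if k <=? i then i + n else i) -> rename f t = lift k n t.
Proof.
  induction t; simpl; intros k p f Hf; auto; try (f_equal; auto; fail).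
  - rewrite Hf. destruct (k <=? n); reflexivity.
  - f_equal; auto. apply IHt2. intros [|i]; simpl; auto.
    rewrite Hf. destruct (k <=? i); auto.
  - f_equal; auto. apply IHt2. intros [|i]; simpl; auto.
    rewrite Hf. destruct (k <=? i); auto.
Qed.

(** Substituting a variable is itself a renaming: index [k] goes to [m + k], since the substituted
    variable is lifted past [k] binders, and larger indices drop by one. The hypotheses say that [f]
    is this renaming followed by [g]. *)
Lemma rename_subst_var (t : term) : forall k m f g,
  (forall i, i < k -> f i = g i) -> f k = g (m + k) ->
  (forall i, k <= i -> f (S i) = g i) ->
  rename f t = rename g (subst k (tVar m) t).
Proof.
  induction t; simpl; intros k p f g Hlt Heq Hgt; auto; try (f_equal; eauto; fail).
  - nat_cases; simpl; f_equal; auto; subst; auto.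
    destruct n as [|n]; simpl; [lia|]. apply Hgt; lia.
  - f_equal; eauto. apply IHt2.
    + intros [|i] Hi; simpl; auto. f_equal; apply Hlt; lia.
    + rewrite <- plus_n_Sm; simpl. auto.
    + intros [|i] Hi; simpl; [lia|]. f_equal; apply Hgt; lia.
  - f_equal; eauto. apply IHt2.
    + intros [|i] Hi; simpl; auto. f_equal; apply Hlt; lia.
    + rewrite <- plus_n_Sm; simpl. auto.
    + intros [|i] Hi; simpl; [lia|]. f_equal; apply Hgt; lia.
Qed.

Section Conversion.
Context {R : rules}.

Lemma conv_refl (t : term) : conv R t t.
Proof. apply rst_refl. Qed.

Lemma conv_sym (t t' : term) : conv R t t' -> conv R t' t.
Proof. apply rst_sym. Qed.

Lemma conv_trans (t1 t2 t3 : term) : conv R t1 t2 -> conv R t2 t3 -> conv R t1 t3.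
Proof. apply rst_trans. Qed.

Lemma conv_beta (A b u : term) : conv R (tApp (tLam A b) u) (subst 0 u b).
Proof. apply rst_step, red1_beta. Qed.

Lemma conv_congr (C : term -> term) :
  (forall t t', red1 R t t' -> red1 R (C t) (C t')) ->
  forall t t', conv R t t' -> conv R (C t) (C t').
Proof.
  intros HC t t' H. induction H.
  - apply rst_step; auto.
  - apply rst_refl.
  - apply rst_sym; auto.
  - eapply rst_trans; eauto.
Qed.

Lemma conv_appl (f f' a : term) : conv R f f' -> conv R (tApp f a) (tApp f' a).
Proof. apply (conv_congr (fun f => tApp f a)). intros; now apply red1_appl. Qed.

(** Both sides are beta-expanded to redexes that differ only in the body of the abstraction, so
    closure of conversion under contexts suffices and nothing is asked of [R]. The domain annotation
    can be any term; [u] is at hand. *)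
Lemma conv_subst (t t' u : term) :
  conv R t t' -> conv R (subst 0 u t) (subst 0 u t').
Proof.
  intro H. apply conv_trans with (tApp (tLam u t) u).
  - apply conv_sym, conv_beta.
  - apply conv_trans with (tApp (tLam u t') u); [|apply conv_beta].
    apply (conv_congr (fun b => tApp (tLam u b) u)); auto.
    intros; now apply red1_appl, red1_lamr.
Qed.

(* The condition on [f] is what remains of an arbitrary renaming of the [n]
   first variables after [n] successive substitutions for variable 0. *)
Lemma conv_rename_prefix (n : nat) : forall f t t',
  (forall i, f (n + i) = i) -> conv R t t' -> conv R (rename f t) (rename f t').
Proof.
  induction n as [|n IHn]; intros f t t' Hf H.
  - now rewrite !rename_id by exact Hf.
  (* Variable 0 is replaced by an index that the remaining renaming sends to [f 0]. Index [n + f 0]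
     does so, because [f (S n + f 0) = f 0] by the condition on [f]. *)
  - assert (E : forall s,
      rename f s = rename (fun i => f (S i)) (subst 0 (tVar (n + f 0)) s)).
    { intro s. apply rename_subst_var; auto; [intros; lia|].
      rewrite Nat.add_0_r. symmetry. apply (Hf (f 0)). }
    rewrite !E. apply IHn; [exact Hf|]. now apply conv_subst.
Qed.

Lemma conv_lift (k n : nat) (t t' : term) :
  conv R t t' -> conv R (lift k n t) (lift k n t').
Proof.
  intro H.
  destruct (closed_exists t) as [m1 H1]. destruct (closed_exists t') as [m2 H2].
  set (N := m1 + m2).
  set (g := fun i => if k <=? i then i + n else i).
  (* Lifting itself need not satisfy the condition of [conv_rename_prefix]. Both terms have their
     variables below [N], so the renaming is redefined from [N] on to be the shift back by [N]. *)
  set (f := fun i => if i <? N then g i else i - N).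
  assert (E : forall s, closed N s -> lift k n s = rename f s).
  { intros s Hs. rewrite <- (rename_lift s k n g) by reflexivity.
    apply (rename_ext s N); auto.
    intros i Hi. unfold f. destruct (Nat.ltb_spec i N); auto; lia. }
  rewrite (E t), (E t').
  - apply (conv_rename_prefix N); auto.
    intro i. unfold f. destruct (Nat.ltb_spec (N + i) N); lia.
  - apply closed_weaken with m2; auto; unfold N; lia.
  - apply closed_weaken with m1; auto; unfold N; lia.
Qed.

End Conversion.

(** * Weakening *)

Scheme typ_mut := Minimality for typ Sort Prop
  with wf_mut := Minimality for wf Sort Prop.
Combined Scheme typ_wf_ind from typ_mut, wf_mut.

(** Each entry is a term over the entries after it, so its cutoff is the length of the tail, not of
    the whole list. *)
Fixpoint lift_ctx (n : nat) (D : context) : context :=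
  match D with
  | [] => []
  | A :: D => lift (length D) n A :: lift_ctx n D
  end.

Lemma lift_ctx_length (n : nat) (D : context) : length (lift_ctx n D) = length D.
Proof. induction D; simpl; auto. Qed.

Lemma lift_ctx_nth (n : nat) (D : context) : forall i A,
  nth_error D i = Some A ->
  nth_error (lift_ctx n D) i = Some (lift (length D - S i) n A).
Proof.
  induction D as [|B D IHD]; intros [|i] A H; simpl in *; try discriminate.
  - injection H as ->. now rewrite Nat.sub_0_r.
  - now apply IHD.
Qed.

Section Typing.
Context {Sg : signature} {R : rules}.

Lemma typ_closed (G : context) (t T : term) :
  typ Sg R G t T -> closed (length G) t.
Proof.
  induction 1; simpl in *; tauto || auto.
  apply nth_error_Some. congruence.
Qed.

Lemma typ_wf (G : context) (t T : term) : typ Sg R G t T -> wf Sg R G.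
Proof. induction 1; auto. Qed.

(** The block [X] is inserted below an arbitrary prefix [D] so that the induction passes under
    binders, which extend [D]. Typing and well-formedness are treated together because each has
    premises of the other kind. *)
Lemma weakening_under :
  (forall G t T, typ Sg R G t T ->
    forall D X G0, G = D ++ G0 -> wf Sg R (X ++ G0) ->
    typ Sg R (lift_ctx (length X) D ++ X ++ G0)
      (lift (length D) (length X) t) (lift (length D) (length X) T)) /\
  (forall G, wf Sg R G ->
    forall D X G0, G = D ++ G0 -> wf Sg R (X ++ G0) ->
    wf Sg R (lift_ctx (length X) D ++ X ++ G0)).
Proof.
  apply (typ_wf_ind Sg R
    (fun G t T => forall D X G0, G = D ++ G0 -> wf Sg R (X ++ G0) ->
      typ Sg R (lift_ctx (length X) D ++ X ++ G0)
        (lift (length D) (length X) t) (lift (length D) (length X) T))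
    (fun G => forall D X G0, G = D ++ G0 -> wf Sg R (X ++ G0) ->
      wf Sg R (lift_ctx (length X) D ++ X ++ G0))).
  - intros G s1 s2 _ IH Hax D X G0 -> HX. simpl. apply t_sort; auto.
  - intros G i A _ IH Hi D X G0 -> HX. simpl.
    (* A variable pointing past [D] is shifted over [X], and the two lifts of its type merge. A
       variable pointing into [D] keeps its index, and its type was already lifted inside
       [lift_ctx], so the two lifts are exchanged. *)
    destruct (Nat.leb_spec (length D) i) as [Hle|Hlt].
    + rewrite lift_lift_merge by lia. rewrite nth_error_app2 in Hi by lia.
      apply t_var; auto.
      rewrite nth_error_app2; rewrite lift_ctx_length; [|lia].
      rewrite nth_error_app2 by lia.
      rewrite <- Hi. f_equal; lia.
    + rewrite nth_error_app1 in Hi by lia.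
      replace (lift (length D) (length X) (lift 0 (S i) A))
        with (lift 0 (S i) (lift (length D - S i) (length X) A)).
      * apply t_var; auto.
        rewrite nth_error_app1 by (rewrite lift_ctx_length; lia).
        now apply lift_ctx_nth.
      * rewrite <- lift_lift_comm by lia. f_equal; lia.
  - intros G c T s _ IH Hc HT _ D X G0 -> HX. simpl.
    (* The type of a constant is typed in the empty context, hence closed. *)
    rewrite lift_closed.
    + apply t_const with s; auto.
    + apply (closed_weaken T 0); [lia|]. exact (typ_closed _ _ _ HT).
  - intros G A B s1 s2 Hr _ IHA _ IHB D X G0 -> HX. simpl.
    apply t_pi with s1; auto. now apply (IHB (A :: D) X G0).
  - intros G A b B s _ IHb _ IHP D X G0 -> HX. simpl.
    apply t_lam with s; [now apply (IHb (A :: D) X G0)|now apply (IHP D X G0)].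
  - intros G f a A B _ IHf _ IHa D X G0 -> HX. simpl.
    (* The ascription replaces the cutoff [0 + length D] by the convertible [length D], so that the
       rewrite finds its left-hand side. *)
    rewrite (lift_subst B 0 (length D) (length X) a
      : lift (length D) (length X) (subst 0 a B) = _).
    apply t_app with (lift (length D) (length X) A); auto.
  - intros G a A B s _ IHa _ IHB HAB D X G0 -> HX.
    apply t_conv with (lift (length D) (length X) A) s; auto.
    now apply conv_lift.
  - intros [|? D] X G0 E HX; simpl in *; [now subst|discriminate].
  - intros G A s HA IHA [|B D] X G0 E HX; simpl in *; auto.
    injection E as <- ->. apply wf_cons with s. now apply (IHA D X G0).
Qed.

Lemma weakening (G : context) (B t T : term) (s : sort) :
  typ Sg R G B (tSort s) -> typ Sg R G t T ->
  typ Sg R (B :: G) (lift 0 1 t) (lift 0 1 T).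
Proof.
  intros HB Ht.
  apply (proj1 weakening_under _ _ _ Ht [] [B] G); auto.
  now apply wf_cons with s.
Qed.

(** * Derived rules *)

Lemma typ_var0 (G : context) (B : term) (s : sort) :
  typ Sg R G B (tSort s) -> typ Sg R (B :: G) (tVar 0) (lift 0 1 B).
Proof. intro HB. apply t_var; [now apply wf_cons with s|reflexivity]. Qed.

Lemma typ_arr (G : context) (A B : term) (s1 s2 : sort) : rule s1 s2 ->
  typ Sg R G A (tSort s1) -> typ Sg R G B (tSort s2) ->
  typ Sg R G (arr A B) (tSort s2).
Proof.
  intros Hr HA HB. apply t_pi with s1; auto.
  exact (weakening _ _ _ _ _ HA HB).
Qed.

Lemma typ_lam_arr (G : context) (A b B : term) (s1 s2 : sort) : rule s1 s2 ->
  typ Sg R G A (tSort s1) -> typ Sg R G B (tSort s2) ->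
  typ Sg R (A :: G) b (lift 0 1 B) -> typ Sg R G (tLam A b) (arr A B).
Proof.
  intros Hr HA HB Hb. apply t_lam with s2; auto. now apply typ_arr with s1.
Qed.

Lemma typ_app_arr (G : context) (f a A B : term) :
  typ Sg R G f (arr A B) -> typ Sg R G a A -> typ Sg R G (tApp f a) B.
Proof.
  intros Hf Ha. rewrite <- (subst_lift_cancel B 0 a). now apply t_app with A.
Qed.

Lemma typ_star (G : context) : wf Sg R G -> typ Sg R G (tSort Star) (tSort Box).
Proof. intro HG. apply t_sort; auto. constructor. Qed.

Lemma typ_bot (G : context) : wf Sg R G -> typ Sg R G bot (tSort Star).
Proof.
  intro HG. apply t_pi with Box; [constructor|now apply typ_star|].
  apply (typ_var0 G (tSort Star) Box). now apply typ_star.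
Qed.

Lemma typ_Pow (G : context) (A : term) :
  typ Sg R G A (tSort Box) -> typ Sg R G (Pow A) (tSort Box).
Proof.
  intro HA. apply typ_arr with Box; auto; [constructor|].
  apply typ_star. now apply typ_wf in HA.
Qed.

Lemma typ_TT (G : context) (A : term) :
  typ Sg R G A (tSort Box) -> typ Sg R G (TT A) (tSort Box).
Proof. intro HA. now apply typ_Pow, typ_Pow. Qed.

End Typing.

Lemma lift_Pow (k n : nat) (A : term) : lift k n (Pow A) = Pow (lift k n A).
Proof. apply lift_arr. Qed.

Lemma lift_TT (k n : nat) (A : term) : lift k n (TT A) = TT (lift k n A).
Proof. unfold TT. now rewrite !lift_Pow. Qed.

Lemma subst_Pow (k : nat) (u A : term) : subst k u (Pow A) = Pow (subst k u A).
Proof. apply subst_arr. Qed.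

Lemma subst_TT (k : nat) (u A : term) : subst k u (TT A) = TT (subst k u A).
Proof. unfold TT. now rewrite !subst_Pow. Qed.

(** * The paradox *)

(** The equality is between terms of type [Pow A], so the predicates quantified over have type
    [TT A]; rule [rl_bs] keeps the result in [Star]. *)
Definition leibniz (A X Y : term) : term :=
  tPi (TT A) (arr (tApp (tVar 0) (lift 0 1 X)) (tApp (tVar 0) (lift 0 1 Y))).

Definition leibniz_refl (A X : term) : term :=
  tLam (TT A) (tLam (tApp (tVar 0) (lift 0 1 X)) (tVar 0)).

(** With the Russell predicate for [X], this is the element of [TT A] to which [intro] is applied to
    form the point. *)
Definition singleton (A X : term) : term :=
  tLam (Pow A) (leibniz (lift 0 1 A) (lift 0 1 X) (tVar 0)).

(** The body of the Russell predicate is kept separate, with [x] as a parameter, so that the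
    beta-reduct of the predicate at any argument is again an instance of it. *)
Definition no_member (A mtch x : term) : term :=
  tPi (Pow A)
    (arr (tApp (tApp (lift 0 1 mtch) (lift 0 1 x)) (tVar 0))
      (arr (tApp (tVar 0) (lift 0 1 x)) bot)).

Definition russell (A mtch : term) : term :=
  tLam A (no_member (lift 0 1 A) (lift 0 1 mtch) (tVar 0)).

(** Here and in the analogues below, the definition lifts its parameters under its own binders, and
    the outer lift or substitution is exchanged with that inner lift. *)
Lemma lift_leibniz (k n : nat) (A X Y : term) :
  lift k n (leibniz A X Y) = leibniz (lift k n A) (lift k n X) (lift k n Y).
Proof.
  unfold leibniz. cbn [lift]. rewrite lift_TT, lift_arr. cbn.
  now rewrite !(lift_lift_comm _ 0 k 1 n) by lia.
Qed.

Lemma lift_singleton (k n : nat) (A X : term) :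
  lift k n (singleton A X) = singleton (lift k n A) (lift k n X).
Proof.
  unfold singleton. cbn [lift]. rewrite lift_Pow, lift_leibniz. cbn.
  now rewrite !(lift_lift_comm _ 0 k 1 n) by lia.
Qed.

Lemma lift_no_member (k n : nat) (A mtch x : term) :
  lift k n (no_member A mtch x) =
  no_member (lift k n A) (lift k n mtch) (lift k n x).
Proof.
  unfold no_member. cbn [lift]. rewrite lift_Pow, !lift_arr. cbn.
  now rewrite !(lift_lift_comm _ 0 k 1 n) by lia.
Qed.

Lemma lift_russell (k n : nat) (A mtch : term) :
  lift k n (russell A mtch) = russell (lift k n A) (lift k n mtch).
Proof.
  unfold russell. cbn [lift]. rewrite lift_no_member. cbn.
  now rewrite !(lift_lift_comm _ 0 k 1 n) by lia.
Qed.

Lemma subst_leibniz (k : nat) (u A X Y : term) :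
  subst k u (leibniz A X Y) = leibniz (subst k u A) (subst k u X) (subst k u Y).
Proof.
  unfold leibniz. cbn [subst]. rewrite subst_TT, subst_arr. cbn.
  now rewrite !subst_lift_comm by lia.
Qed.

Lemma subst_no_member (k : nat) (u A mtch x : term) :
  subst k u (no_member A mtch x) =
  no_member (subst k u A) (subst k u mtch) (subst k u x).
Proof.
  unfold no_member. cbn [subst]. rewrite subst_Pow, !subst_arr. cbn.
  now rewrite !subst_lift_comm by lia.
Qed.

(** * Conversion, typing and the contradiction inside the calculus *)

Section Paradox.
Context {Sg : signature} {R : rules}.

Lemma conv_russell (A mtch x : term) :
  conv R (tApp (russell A mtch) x) (no_member A mtch x).
Proof.
  eapply conv_trans; [apply conv_beta|].
  rewrite subst_no_member, !subst_lift_cancel. cbn. rewrite lift_0.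
  apply conv_refl.
Qed.

Lemma conv_singleton (A X Y : term) :
  conv R (tApp (singleton A X) Y) (leibniz A X Y).
Proof.
  eapply conv_trans; [apply conv_beta|].
  rewrite subst_leibniz, !subst_lift_cancel. cbn. rewrite lift_0.
  apply conv_refl.
Qed.

Section Leibniz.
Context {G : context} {A X : term}.
Hypothesis typ_A : typ Sg R G A (tSort Box).
Hypothesis typ_X : typ Sg R G X (Pow A).

Lemma typ_TT_app (Y : term) : typ Sg R G Y (Pow A) ->
  typ Sg R (TT A :: G) (tApp (tVar 0) (lift 0 1 Y)) (tSort Star).
Proof.
  intro HY. pose proof (typ_TT _ _ typ_A) as HT.
  apply typ_app_arr with (Pow (lift 0 1 A)).
  - change (arr (Pow (lift 0 1 A)) (tSort Star)) with (TT (lift 0 1 A)).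
    rewrite <- lift_TT. now apply typ_var0 with Box.
  - rewrite <- lift_Pow. now apply weakening with Box.
Qed.

Lemma typ_leibniz (Y : term) : typ Sg R G Y (Pow A) ->
  typ Sg R G (leibniz A X Y) (tSort Star).
Proof.
  intro HY. apply t_pi with Box; [constructor|now apply typ_TT|].
  apply typ_arr with Star; [constructor| |]; now apply typ_TT_app.
Qed.

Lemma typ_leibniz_refl : typ Sg R G (leibniz_refl A X) (leibniz A X X).
Proof.
  apply t_lam with Star; [|now apply typ_leibniz].
  pose proof (typ_TT_app _ typ_X) as HX.
  apply typ_lam_arr with Star Star; auto; [constructor|].
  now apply typ_var0 with Star.
Qed.

Lemma typ_leibniz_elim (Y e P : term) :
  typ Sg R G e (leibniz A X Y) -> typ Sg R G P (TT A) ->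
  typ Sg R G (tApp e P) (arr (tApp P X) (tApp P Y)).
Proof.
  intros He HP. pose proof (t_app _ _ _ _ _ _ _ He HP) as H.
  rewrite subst_arr in H. cbn in H.
  now rewrite lift_0, !subst_lift_cancel in H.
Qed.

End Leibniz.

Lemma typ_singleton (G : context) (A X : term) :
  typ Sg R G A (tSort Box) -> typ Sg R G X (Pow A) ->
  typ Sg R G (singleton A X) (TT A).
Proof.
  intros HA HX. pose proof (typ_Pow _ _ HA) as HP.
  apply typ_lam_arr with Box Box; auto; [constructor|..].
  - apply typ_star. now apply typ_wf in HA.
  - apply typ_leibniz.
    + exact (weakening _ _ _ _ _ HP HA).
    + rewrite <- lift_Pow. exact (weakening _ _ _ _ _ HP HX).
    + rewrite <- lift_Pow. now apply typ_var0 with Box.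
Qed.

Lemma typ_no_member (G : context) (A mtch x : term) :
  typ Sg R G A (tSort Box) -> typ Sg R G mtch (arr A (TT A)) ->
  typ Sg R G x A -> typ Sg R G (no_member A mtch x) (tSort Star).
Proof.
  intros HA Hm Hx. pose proof (typ_Pow _ _ HA) as HP.
  pose proof (typ_var0 _ _ _ HP) as Hv. rewrite lift_Pow in Hv.
  pose proof (weakening _ _ _ _ _ HP Hx) as Hx1.
  pose proof (weakening _ _ _ _ _ HP Hm) as Hm1. rewrite lift_arr, lift_TT in Hm1.
  apply t_pi with Box; [constructor|auto|].
  apply typ_arr with Star; [constructor| |].
  - eapply typ_app_arr; [|exact Hv]. exact (typ_app_arr _ _ _ _ _ Hm1 Hx1).
  - apply typ_arr with Star; [constructor| |].
    + exact (typ_app_arr _ _ _ _ _ Hv Hx1).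
    + apply typ_bot. now apply typ_wf in Hv.
Qed.

Lemma typ_russell (G : context) (A mtch : term) :
  typ Sg R G A (tSort Box) -> typ Sg R G mtch (arr A (TT A)) ->
  typ Sg R G (russell A mtch) (Pow A).
Proof.
  intros HA Hm. apply typ_lam_arr with Box Box; auto; [constructor|..].
  - apply typ_star. now apply typ_wf in HA.
  - apply typ_no_member.
    + exact (weakening _ _ _ _ _ HA HA).
    + rewrite <- lift_TT, <- lift_arr. exact (weakening _ _ _ _ _ HA Hm).
    + now apply typ_var0 with Box.
Qed.

Lemma typ_no_member_elim (G : context) (A mtch x h p : term) :
  typ Sg R G h (no_member A mtch x) -> typ Sg R G p (Pow A) ->
  typ Sg R G (tApp h p)
    (arr (tApp (tApp mtch x) p) (arr (tApp p x) bot)).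
Proof.
  intros Hh Hp. pose proof (t_app _ _ _ _ _ _ _ Hh Hp) as H.
  rewrite !subst_arr in H. cbn in H.
  now rewrite lift_0, !subst_lift_cancel in H.
Qed.

(** This isolates what the argument takes from the retraction: a single conversion at a single term.
    [intro] no longer appears, and the package can be moved to an extended context. *)
Record russell_point (G : context) (A mtch a : term) : Prop := {
  point_A : typ Sg R G A (tSort Box);
  point_match : typ Sg R G mtch (arr A (TT A));
  point_typ : typ Sg R G a A;
  point_conv : conv R (tApp mtch a) (singleton A (russell A mtch)) }.

(** Proofs by hypothesis are carried out in a context extended by that hypothesis, so the point must
    follow. Its conversion is transported by [conv_lift]. *)
Lemma russell_point_weaken (G : context) (A mtch a B : term) (s : sort) :
  typ Sg R G B (tSort s) -> russell_point G A mtch a ->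
  russell_point (B :: G) (lift 0 1 A) (lift 0 1 mtch) (lift 0 1 a).
Proof.
  intros HB [HA Hm Ha Hc]. split.
  - exact (weakening _ _ _ _ _ HB HA).
  - rewrite <- lift_TT, <- lift_arr. exact (weakening _ _ _ _ _ HB Hm).
  - exact (weakening _ _ _ _ _ HB Ha).
  - rewrite <- lift_russell, <- lift_singleton. exact (conv_lift 0 1 _ _ Hc).
Qed.

Section Point.
Context {G : context} {A mtch a : term}.
Hypothesis Hpt : russell_point G A mtch a.

Lemma conv_match_point (Y : term) :
  conv R (tApp (tApp mtch a) Y) (leibniz A (russell A mtch) Y).
Proof.
  eapply conv_trans; [exact (conv_appl _ _ _ (point_conv _ _ _ _ Hpt))|].
  apply conv_singleton.
Qed.

Lemma typ_match_point (Y : term) : typ Sg R G Y (Pow A) ->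
  typ Sg R G (tApp (tApp mtch a) Y) (tSort Star).
Proof.
  destruct Hpt as [_ Hm Ha _]. intro HY.
  eapply typ_app_arr; [|exact HY]. exact (typ_app_arr _ _ _ _ _ Hm Ha).
Qed.

Lemma typ_russell_point : typ Sg R G (tApp (russell A mtch) a) (tSort Star).
Proof.
  destruct Hpt as [HA Hm Ha _].
  exact (typ_app_arr _ _ _ _ _ (typ_russell _ _ _ HA Hm) Ha).
Qed.

(** The term is [h] applied to the Russell predicate, to reflexivity and to [h] itself: [h] is used
    both as the universal statement and as the membership that its own instance refutes. *)
Lemma russell_point_absurd (h : term) :
  typ Sg R G h (tApp (russell A mtch) a) -> exists t, typ Sg R G t bot.
Proof.
  intro Hh. destruct Hpt as [HA Hm Ha _].
  pose proof (typ_russell _ _ _ HA Hm) as HR.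
  eexists. eapply typ_app_arr; [|exact Hh].
  eapply typ_app_arr.
  - eapply typ_no_member_elim; [|exact HR].
    eapply t_conv; [exact Hh|exact (typ_no_member _ _ _ _ HA Hm Ha)|apply conv_russell].
  (* Matching the point against the Russell predicate is, up to conversion, the equality of that
     predicate with itself. *)
  - eapply t_conv; [exact (typ_leibniz_refl HA HR)|exact (typ_match_point _ HR)|].
    apply conv_sym, conv_match_point.
Qed.

End Point.

(** The preceding absurdity is derived for variable 0 in the context extended by the assumption,
    which is then abstracted. *)
Lemma not_russell_point (G : context) (A mtch a : term) :
  russell_point G A mtch a ->
  exists t, typ Sg R G t (arr (tApp (russell A mtch) a) bot).
Proof.
  intro Hpt. pose proof (typ_russell_point Hpt) as HRa.
  pose proof (typ_var0 _ _ _ HRa) as Hv. cbn [lift] in Hv.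
  rewrite lift_russell in Hv.
  destruct (russell_point_absurd (russell_point_weaken _ _ _ _ _ _ HRa Hpt) _ Hv)
    as [t Ht].
  eexists. eapply typ_lam_arr; [apply rl_ss|exact HRa| |exact Ht].
  apply typ_bot. now apply typ_wf in HRa.
Qed.

(** By conversion [e] proves that the Russell predicate equals [p], and the negation given by
    [not_russell_point] is transported along this equality. *)
Lemma match_point_elim (G : context) (A mtch a p e : term) :
  russell_point G A mtch a -> typ Sg R G p (Pow A) ->
  typ Sg R G e (tApp (tApp mtch a) p) ->
  exists t, typ Sg R G t (arr (tApp p a) bot).
Proof.
  intros Hpt Hp He.
  destruct (not_russell_point _ _ _ _ Hpt) as [n Hn].
  pose proof (conv_match_point Hpt p) as Hmp.
  destruct Hpt as [HA Hm Ha _].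
  pose proof (typ_russell _ _ _ HA Hm) as HR.
  pose proof (typ_Pow _ _ HA) as HP.
  (* The context and the type are generalised because the fact is used both in [G] and under the
     binder of [P], where [A] is lifted. *)
  assert (Hneg : forall G q b B, typ Sg R G q (Pow B) -> typ Sg R G b B ->
    typ Sg R G (arr (tApp q b) bot) (tSort Star)).
  { intros G0 q b B Hq Hb. apply typ_arr with Star; [constructor| |].
    - exact (typ_app_arr _ _ _ _ _ Hq Hb).
    - apply typ_bot. now apply typ_wf in Hb. }
  (* The motive of the rewriting: a predicate [q] is sent to the negation of [q a]. *)
  set (P := tLam (Pow A) (arr (tApp (tVar 0) (lift 0 1 a)) bot)).
  assert (HPt : typ Sg R G P (TT A)).
  { apply typ_lam_arr with Box Box; auto; [constructor|..].
    - apply typ_star. now apply typ_wf in HA.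
    - apply Hneg with (lift 0 1 A).
      + rewrite <- lift_Pow. now apply typ_var0 with Box.
      + exact (weakening _ _ _ _ _ HP Ha). }
  assert (HPc : forall q, conv R (tApp P q) (arr (tApp q a) bot)).
  { intro q. eapply conv_trans; [apply conv_beta|].
    rewrite subst_arr. cbn. rewrite lift_0, subst_lift_cancel. apply conv_refl. }
  eexists. eapply t_conv; [|exact (Hneg _ _ _ _ Hp Ha)|apply HPc].
  eapply typ_app_arr.
  - eapply typ_leibniz_elim; [|exact HPt].
    eapply t_conv; [exact He|exact (typ_leibniz HA HR _ Hp)|exact Hmp].
  - eapply t_conv; [exact Hn| |apply conv_sym, HPc].
    exact (typ_app_arr _ _ _ _ _ HPt HR).
Qed.

Lemma match_point_imp (G : context) (A mtch a p : term) :
  russell_point G A mtch a -> typ Sg R G p (Pow A) ->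
  exists t,
    typ Sg R G t (arr (tApp (tApp mtch a) p) (arr (tApp p a) bot)).
Proof.
  intros Hpt Hp.
  pose proof (typ_match_point Hpt _ Hp) as HM.
  pose proof (typ_var0 _ _ _ HM) as Hv. cbn [lift] in Hv.
  pose proof (weakening _ _ _ _ _ HM Hp) as Hp1. rewrite lift_Pow in Hp1.
  destruct (match_point_elim _ _ _ _ _ _
    (russell_point_weaken _ _ _ _ _ _ HM Hpt) Hp1 Hv) as [t Ht].
  eexists. eapply typ_lam_arr; [apply rl_ss|exact HM| |].
  - apply typ_arr with Star; [constructor| |].
    + exact (typ_app_arr _ _ _ _ _ Hp (point_typ _ _ _ _ Hpt)).
    + apply typ_bot. now apply typ_wf in Hp.
  - rewrite lift_arr. exact Ht.
Qed.

(** [match_point_imp] is applied to a fresh variable standing for the generic predicate. Abstracting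
    it proves [no_member] at [a], which converts back to the Russell predicate applied to [a]. *)
Lemma russell_holds_at_point (G : context) (A mtch a : term) :
  russell_point G A mtch a ->
  exists t, typ Sg R G t (tApp (russell A mtch) a).
Proof.
  intro Hpt. pose proof (typ_Pow _ _ (point_A _ _ _ _ Hpt)) as HP.
  pose proof (typ_var0 _ _ _ HP) as Hv. rewrite lift_Pow in Hv.
  destruct (match_point_imp _ _ _ _ _
    (russell_point_weaken _ _ _ _ _ _ HP Hpt) Hv) as [t Ht].
  pose proof (typ_russell_point Hpt) as HRa.
  destruct Hpt as [HA Hm Ha _].
  eexists. eapply t_conv; [|exact HRa|apply conv_sym, conv_russell].
  eapply t_lam; [exact Ht|]. now apply typ_no_member.
Qed.

End Paradox.

Theorem theorem1 :
  forall (Sg : signature) (R : rules) (G : context) (A intro mtch : term),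
    typ Sg R G A (tSort Box) ->
    typ Sg R G intro (arr (TT A) A) ->
    typ Sg R G mtch (arr A (TT A)) ->
    (forall (D : context) (u : term),
        typ Sg R (D ++ G) u (lift 0 (length D) (TT A)) ->
        conv R (tApp (lift 0 (length D) mtch)
                     (tApp (lift 0 (length D) intro) u)) u) ->
    exists p : term, typ Sg R G p bot.
Proof.
  intros Sg R G A intro mtch HA Hi Hm Hretr.
  pose proof (typ_singleton _ _ _ HA (typ_russell _ _ _ HA Hm)) as Hs.
  assert (Hpt : russell_point (Sg := Sg) (R := R) G A mtch
    (tApp intro (singleton A (russell A mtch)))).
  { split; auto.
    - exact (typ_app_arr _ _ _ _ _ Hi Hs).
    (* The retraction is taken at the empty extension, where every lift is by 0 and hence the
       identity. *)
    - specialize (Hretr [] (singleton A (russell A mtch))). simpl in Hretr.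
      rewrite !lift_0 in Hretr. now apply Hretr. }
  destruct (russell_holds_at_point _ _ _ _ Hpt) as [t Ht].
  exact (russell_point_absurd Hpt t Ht).
Qed.
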